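(* Let $\mathfrak g=\mathfrak h\oplus\mathfrak k$ be a semidirect product Lie algebra, with $\mathfrak h$ a subalgebra, $\mathfrak k$ an ideal and associated representation $\pi:\mathfrak h\to\operatorname{End}(\mathfrak k)$, and let $j:\mathfrak h\to\mathfrak k$ be a linear isomorphism. Let $J$ be the almost complex structure $J(x+v)=-j^{-1}v+jx$ and $F$ the paracomplex structure $F(x+v)=x-v$, for $x\in\mathfrak h$, $v\in\mathfrak k$. Then there exists a torsion-free connection $\nabla$ on $\mathfrak g$ such that $\nabla F=0$ and $\nabla J=0$ if and only if $J$ is integrable. Moreover, such a connection is uniquely determined by $$\nabla_{x_1+jy_1}(x_2+jy_2)=\tilde\pi(x_1)x_2+\pi(x_1)jy_2,\qquad x_1,x_2,y_1,y_2\in\mathfrak h,$$ where $\tilde\pi(x_1)\in\operatorname{End}(\mathfrak h)$ is given by $\tilde\pi(x_1)x_2=j^{-1}\pi(x_1)jx_2$.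
   Context: All Lie algebras are real and finite-dimensional. A semidirect product Lie algebra $\mathfrak g=\mathfrak h\oplus\mathfrak k$ is a vector space direct sum of a Lie subalgebra $\mathfrak h$ and an ideal $\mathfrak k$; its bracket is $[x,y]=[x,y]_{\mathfrak h}$, $[x,v]=\pi(x)v$, $[u,v]=[u,v]_{\mathfrak k}$ for $x,y\in\mathfrak h$, $u,v\in\mathfrak k$, where $\pi:\mathfrak h\to\operatorname{End}(\mathfrak k)$ is a representation acting by derivations of $\mathfrak k$. A connection on $\mathfrak g$ is a bilinear map $\nabla:\mathfrak g\times\mathfrak g\to\mathfrak g$, $(X,Y)\mapsto\nabla_XY$. It is torsion-free if $\nabla_XY-\nabla_YX=[X,Y]$ for all $X,Y\in\mathfrak g$. For a linear map $S:\mathfrak g\to\mathfrak g$, $\nabla S=0$ means $\nabla_X(SY)=S(\nabla_XY)$ for all $X,Y\in\mathfrak g$. $J$ is integrable if $N_J(Y,Z)=[JY,JZ]-[Y,Z]-J[JY,Z]-J[Y,JZ]=0$ for all $Y,Z\in\mathfrak g$. *)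

(* Defs.v *)
From HB Require Import structures.
From mathcomp Require Import all_boot all_order all_algebra.
From mathcomp Require Export reals.

Set Implicit Arguments.
Unset Strict Implicit.
Unset Printing Implicit Defensive.

Import GRing.Theory.
Local Open Scope ring_scope.

HB.mixin Record Vector_isLieAlgebra (R : fieldType) L of Vector R L := {
  lie : {bilinear L -> L -> L};
  liexx : forall X : L, lie X X = 0;
  lie_jacobi : forall X Y Z : L,
    lie X (lie Y Z) + lie Y (lie Z X) + lie Z (lie X Y) = 0
}.

#[short(type="lieAlgType")]
HB.structure Definition LieAlgebra (R : fieldType) :=
  { L of Vector_isLieAlgebra R L & Vector R L }.

Arguments lie {R s}.

Record is_semidirect (R : fieldType) (g : lieAlgType R) (h k : {vspace g}) :
    Prop := IsSemidirect {
  semidirect_add : (h + k = fullv)%VS;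
  semidirect_cap : (h :&: k = 0)%VS;
  semidirect_subalg : forall x y : g, x \in h -> y \in h -> lie x y \in h;
  semidirect_ideal : forall X v : g, v \in k -> lie X v \in k
}.

Section Semidirect.
Variables (R : fieldType) (g : lieAlgType R) (h k : {vspace g}).

(* The components of X = x + v: vsproj alone would project along an arbitrary
   complement, whereas daddv_pi h k and daddv_pi k h project along the other
   summand. *)
Definition hpart : 'Hom(g, subvs_of h) := (linfun (vsproj h) \o daddv_pi h k)%VF.
Definition kpart : 'Hom(g, subvs_of k) := (linfun (vsproj k) \o daddv_pi k h)%VF.

(* When k is an ideal, [x, v] is in k and vsproj only recasts it. *)
Definition semirep (x : subvs_of h) : 'End(subvs_of k) :=
  (linfun (vsproj k) \o linfun (lie (vsval x)) \o linfun vsval)%VF.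

Definition paracomplex : 'End(g) :=
  (linfun vsval \o hpart)%VF - (linfun vsval \o kpart)%VF.

Variable j : 'Hom(subvs_of h, subvs_of k).

(* (j^-1)%VF is the inverse of j as soon as j is bijective. *)
Definition almost_complex : 'End(g) :=
  (linfun vsval \o j \o hpart)%VF - (linfun vsval \o j^-1 \o kpart)%VF.

Definition semirep_tilde (x : subvs_of h) : 'End(subvs_of h) :=
  (j^-1 \o semirep x \o j)%VF.

End Semidirect.

Lemma daddv_pi_eq0 (K : fieldType) (V : vectType K) (U W : {vspace V}) (w : V) :
  (U :&: W = 0)%VS -> w \in W -> daddv_pi U W w = 0.
Proof.
move=> UW0 Ww; have WU0 : (W :&: U = 0)%VS by rewrite capvC.
have UWw : w \in (U + W)%VS by rewrite (subvP (addvSr U W)).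
by apply: (addIr w); rewrite add0r -{2}(daddv_pi_id WU0 Ww) daddv_pi_add.
Qed.

Section SemidirectTheory.
Variables (R : fieldType) (g : lieAlgType R) (h k : {vspace g}).
Implicit Types (x y : subvs_of h) (u v : subvs_of k).
Implicit Type j : 'Hom(subvs_of h, subvs_of k).

Lemma hpartE x v : is_semidirect h k -> hpart h k (vsval x + vsval v) = x.
Proof.
move=> /semidirect_cap hk0; rewrite comp_lfunE linearD /=.
rewrite (daddv_pi_id hk0 (subvsP x)) (daddv_pi_eq0 hk0 (subvsP v)).
by rewrite addr0 lfunE /= vsvalK.
Qed.

Lemma kpartE x v : is_semidirect h k -> kpart h k (vsval x + vsval v) = v.
Proof.
move=> /semidirect_cap hk0; have kh0 : (k :&: h = 0)%VS by rewrite capvC.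
rewrite comp_lfunE linearD /= (daddv_pi_id kh0 (subvsP v)).
by rewrite (daddv_pi_eq0 kh0 (subvsP x)) add0r lfunE /= vsvalK.
Qed.

Lemma semirepE x v :
  is_semidirect h k -> vsval (semirep k x v) = lie (vsval x) (vsval v).
Proof.
move=> hk; rewrite !comp_lfunE !lfunE /= vsprojK //.
exact: (semidirect_ideal hk) (subvsP v).
Qed.

Lemma paracomplexE x v :
  is_semidirect h k -> paracomplex h k (vsval x + vsval v) = vsval x - vsval v.
Proof.
move=> hk; rewrite add_lfunE opp_lfunE.
by rewrite (comp_lfunE _ (hpart _ _)) (comp_lfunE _ (kpart _ _)) hpartE // kpartE // !lfunE.
Qed.

Lemma almost_complexE j x v :
  is_semidirect h k ->
  almost_complex j (vsval x + vsval v) = - vsval (j^-1%VF v) + vsval (j x).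
Proof.
move=> hk; rewrite add_lfunE opp_lfunE addrC.
rewrite (comp_lfunE _ (hpart _ _)) (comp_lfunE _ (kpart _ _)) hpartE // kpartE //.
by rewrite !comp_lfunE !(lfunE vsval).
Qed.

End SemidirectTheory.

Section Connection.
Variables (R : fieldType) (g : lieAlgType R).
Implicit Types (nabla : {bilinear g -> g -> g}) (S J : 'End(g)).

Definition torsion_free nabla :=
  forall X Y : g, nabla X Y - nabla Y X = lie X Y.

Definition parallel nabla S :=
  forall X Y : g, nabla X (S Y) = S (nabla X Y).

Definition nijenhuis J (Y Z : g) : g :=
  lie (J Y) (J Z) - lie Y Z - J (lie (J Y) Z) - J (lie Y (J Z)).

Definition integrable J := forall Y Z : g, nijenhuis J Y Z = 0.

End Connection.

(* Main.v *)
(* If a torsion-free nabla preserves the decomposition g = h + k, comparing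
   components in nabla_x v - nabla_v x = pi(x) v for x in h and v in k gives
   nabla_x v = pi(x) v and nabla_v x = 0, and nabla J = 0 then forces
   nabla_x y = j^-1 pi(x) j y and nabla_v (j y) = 0.  Such a nabla makes N_J
   vanish identically.  Conversely, the two components of N_J(x, y) = 0 for
   x, y in h say that k is abelian and that
   [x, y] = j^-1 pi(x) j y - j^-1 pi(y) j x, which is what is needed for the
   connection given by these formulas to be torsion-free. *)
Require Import Defs.
From HB Require Import structures.
From mathcomp Require Import all_boot all_order all_algebra.
From mathcomp Require Import reals.

Import GRing.Theory Num.Theory.

Local Open Scope ring_scope.

Section Connections.
Variables (R : fieldType) (g : lieAlgType R).
Implicit Types (nabla : {bilinear g -> g -> g}) (J : 'End(g)).

Lemma lieC (X Y : g) : lie X Y = - lie Y X.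
Proof.
apply/eqP; rewrite -addr_eq0; apply/eqP.
by have := liexx (X + Y); rewrite linearDl /= !linearDr /= !liexx addr0 add0r.
Qed.

(** Torsion-freeness turns each bracket of N_J into a difference of covariant derivatives. Pulling
    [J] out of the second argument and using J^2 = -1, the eight resulting terms cancel in pairs. *)
Lemma torsion_free_parallel_integrable nabla J :
  (forall X, J (J X) = - X) -> torsion_free nabla -> parallel nabla J ->
  integrable J.
Proof.
move=> JJ tf pJ Y Z; rewrite /nijenhuis -!tf !pJ !linearB /= !JJ.
set a := J _; set b := J _; set c := nabla _ _; set d := nabla _ _.
rewrite !opprK [- c + d]addrC [a - b + _]addrACA -!opprD [b + c]addrC.
by rewrite [_ - (c + b)]addrC addrK addNr.
Qed.

End Connections.

Section Semidirect.
Variables (R : fieldType) (g : lieAlgType R) (h k : {vspace g}).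
Variable hk : is_semidirect h k.
Variable j : 'Hom(subvs_of h, subvs_of k).
Implicit Types (x y : subvs_of h) (u v : subvs_of k).

Lemma semidirect_decomp (X : g) :
  X = vsval (hpart h k X) + vsval (kpart h k X).
Proof.
have : X \in (h + k)%VS by rewrite (semidirect_add hk) memvf.
case/memv_addP => a ah [b bk ->].
by rewrite -(vsprojK ah) -(vsprojK bk) hpartE // kpartE.
Qed.

Lemma semidirect_inj x y u v :
  vsval x + vsval u = vsval y + vsval v -> x = y /\ u = v.
Proof.
move=> e; split.
  by rewrite -(hpartE x u hk) e hpartE.
by rewrite -(kpartE x u hk) e kpartE.
Qed.

Lemma paracomplex_h x : paracomplex h k (vsval x) = vsval x.
Proof. by have := paracomplexE x 0 hk; rewrite linear0 addr0 subr0. Qed.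

Lemma paracomplex_k v : paracomplex h k (vsval v) = - vsval v.
Proof. by have := paracomplexE 0 v hk; rewrite linear0 add0r sub0r. Qed.

Lemma almost_complex_h x : almost_complex j (vsval x) = vsval (j x).
Proof. by have := almost_complexE j x 0 hk; rewrite !linear0 addr0 add0r. Qed.

Lemma almost_complex_k v : almost_complex j (vsval v) = - vsval (j^-1%VF v).
Proof. by have := almost_complexE j 0 v hk; rewrite !linear0 addr0 add0r. Qed.

(** Comparing k-components gives 2v = 0 for the k-part v of [X], and 2 is invertible. *)
Lemma paracomplex_fixed (X : g) : 2%:R != 0 :> R ->
  paracomplex h k X = X -> exists x, X = vsval x.
Proof.
move=> two; rewrite {1 2}(semidirect_decomp X) paracomplexE // => /addrI/eqP.
rewrite eq_sym -subr_eq0 opprK -mulr2n -scaler_nat scaler_eq0 (negPf two) /=.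
move=> /eqP k0; exists (hpart h k X).
by rewrite {1}(semidirect_decomp X) k0 addr0.
Qed.

Lemma paracomplex_antifixed (X : g) : 2%:R != 0 :> R ->
  paracomplex h k X = - X -> exists v, X = vsval v.
Proof.
move=> two; rewrite {1 2}(semidirect_decomp X) paracomplexE // opprD => /addIr/eqP.
rewrite -subr_eq0 opprK -mulr2n -scaler_nat scaler_eq0 (negPf two) /=.
move=> /eqP h0; exists (kpart h k X).
by rewrite {1}(semidirect_decomp X) h0 add0r.
Qed.

Hypothesis j_bij : bijective j.

Lemma jK : cancel j j^-1%VF.
Proof. by apply: lker0_lfunK; apply/lker0P; exact: bij_inj. Qed.

Lemma jVK : cancel j^-1%VF j.
Proof. by have [f fK Kf] := j_bij; move=> v; rewrite -(Kf v) jK. Qed.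

Lemma almost_complex_j x : almost_complex j (vsval (j x)) = - vsval x.
Proof. by rewrite almost_complex_k jK. Qed.

Lemma semidirect_decompj (X : g) : exists x y, X = vsval x + vsval (j y).
Proof.
exists (hpart h k X), (j^-1%VF (kpart h k X)).
by rewrite jVK -semidirect_decomp.
Qed.

Lemma almost_complexK (X : g) :
  almost_complex j (almost_complex j X) = - X.
Proof.
have [x [y ->]] := semidirect_decompj X.
rewrite linearD /= almost_complex_h almost_complex_j linearB /=.
by rewrite almost_complex_h almost_complex_j opprD.
Qed.

(** On k, which contains [x, j y], the map J is -j^-1. The right-hand side is the shape in which
    this term occurs in N_J. *)
Lemma semirep_tildeE x y :
  vsval (semirep_tilde j x y)
  = - almost_complex j (lie (vsval x) (vsval (j y))).
Proof.
by rewrite -semirepE // almost_complex_k opprK !comp_lfunE.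
Qed.

Section Compatible.
Variable nabla : {bilinear g -> g -> g}.
Hypotheses (two : 2%:R != 0 :> R) (tf : torsion_free nabla).
Hypotheses (pF : parallel nabla (paracomplex h k)).
Hypotheses (pJ : parallel nabla (almost_complex j)).

Lemma nabla_hk x v :
  nabla (vsval x) (vsval v) = vsval (semirep k x v) /\
  nabla (vsval v) (vsval x) = 0.
Proof.
(* Each nabla_X commutes with F, hence preserves its eigenspaces h and k. *)
have [a Ea] : exists a : subvs_of k, nabla (vsval x) (vsval v) = vsval a.
  apply: paracomplex_antifixed => //.
  by rewrite -pF paracomplex_k linearNr.
have [b Eb] : exists b : subvs_of h, nabla (vsval v) (vsval x) = vsval b.
  by apply: paracomplex_fixed => //; rewrite -pF paracomplex_h.
have := tf (vsval x) (vsval v); rewrite Ea Eb -semirepE // => e.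
have /semidirect_inj[b0 ->] :
    vsval (- b) + vsval a = vsval (0 : subvs_of h) + vsval (semirep k x v).
  by rewrite linearN linear0 /= add0r addrC.
by split=> //; move/eqP: b0; rewrite oppr_eq0 => /eqP ->; rewrite linear0.
Qed.

Lemma nablaE x1 x2 y1 y2 :
  nabla (vsval x1 + vsval (j y1)) (vsval x2 + vsval (j y2))
  = vsval (semirep_tilde j x1 x2) + vsval (semirep k x1 (j y2)).
Proof.
have [Exk _] := nabla_hk x1 (j y2); have [_ Ekh] := nabla_hk x2 (j y1).
(* Here j y2 = J y2, and J comes out of nabla_{j y1} y2 = 0. *)
have Ekk : nabla (vsval (j y1)) (vsval (j y2)) = 0.
  by rewrite -(almost_complex_h y2) pJ (nabla_hk y2 (j y1)).2 linear0.
(* Apply -J to J (nabla_{x1} x2) = nabla_{x1} (j x2) = pi(x1) j x2. *)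
have Ehh : nabla (vsval x1) (vsval x2) = vsval (semirep_tilde j x1 x2).
  rewrite semirep_tildeE -semirepE // -(nabla_hk x1 (j x2)).1.
  by rewrite -almost_complex_h pJ almost_complexK opprK.
by rewrite linearDl /= !linearDr /= Ehh Exk Ekh Ekk !addr0.
Qed.

End Compatible.

(** Taking the projection onto h along k as an endomorphism of g lets the connection be a closed
    expression in X and Y, from which bilinearity can be read off. *)
Definition hproj : 'End(g) := (linfun vsval \o hpart h k)%VF.

Lemma hprojE x y : hproj (vsval x + vsval (j y)) = vsval x.
Proof. by rewrite comp_lfunE hpartE // lfunE. Qed.

(* For x, y in h one has - J [x, j y] = j^-1 pi(x) j y. *)
Definition semidirect_conn (X Y : g) : g :=
  lie (hproj X) (Y - hproj Y)
  - almost_complex j (lie (hproj X) (almost_complex j (hproj Y))).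

Lemma semidirect_conn_bilinear :
  bilinear_for *:%R *:%R semidirect_conn.
Proof.
split=> Z a X Y; rewrite /semidirect_conn.
  rewrite [hproj (_ + _)]linearP /= linearDl linearZl_LR /=.
  rewrite [lie (_ + _) (almost_complex _ _)]linearDl linearZl_LR /=.
  by rewrite linearP /= scalerBr opprD addrACA.
rewrite [hproj (_ + _)]linearP /= opprD addrACA -scalerBr linearDr linearZr_LR /=.
rewrite linearP /= [lie _ (_ *: _ + _)]linearDr linearZr_LR /=.
by rewrite linearP /= [in RHS]scalerBr opprD addrACA.
Qed.

HB.instance Definition _ :=
  bilinear_isBilinear.Build R g g g *:%R *:%R semidirect_conn
    semidirect_conn_bilinear.

Lemma semidirect_connE x1 y1 x2 y2 :
  semidirect_conn (vsval x1 + vsval (j y1)) (vsval x2 + vsval (j y2))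
  = vsval (semirep_tilde j x1 x2) + vsval (semirep k x1 (j y2)).
Proof.
rewrite /semidirect_conn !hprojE addrAC subrr add0r almost_complex_h.
by rewrite semirep_tildeE semirepE // addrC.
Qed.

(** The connection acts on the second argument componentwise, so it commutes with a sign change on
    k. *)
Lemma semidirect_conn_parallelF : parallel semidirect_conn (paracomplex h k).
Proof.
move=> X Y; have [x1 [y1 ->]] := semidirect_decompj X.
have [x2 [y2 ->]] := semidirect_decompj Y.
rewrite /= semidirect_connE !paracomplexE //.
have -> : vsval x2 - vsval (j y2) = vsval x2 + vsval (j (- y2)).
  by rewrite !linearN.
by rewrite /= semidirect_connE !linearN.
Qed.

(** This amounts to j intertwining tilde pi(x1) with pi(x1), which holds by definition of tilde
    pi. *)
Lemma semidirect_conn_parallelJ : parallel semidirect_conn (almost_complex j).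
Proof.
move=> X Y; have [x1 [y1 ->]] := semidirect_decompj X.
have [x2 [y2 ->]] := semidirect_decompj Y.
rewrite /= semidirect_connE !almost_complexE // jK.
have -> : - vsval y2 + vsval (j x2) = vsval (- y2) + vsval (j x2).
  by rewrite linearN.
by rewrite semidirect_connE linearN /= !comp_lfunE /= jVK.
Qed.

Lemma integrable_components x y : integrable (almost_complex j) ->
  lie (vsval (j x)) (vsval (j y)) = 0 /\
  vsval (semirep_tilde j x y) - vsval (semirep_tilde j y x)
    = lie (vsval x) (vsval y).
Proof.
move=> /(_ (vsval x) (vsval y)); rewrite /nijenhuis !almost_complex_h.
set c := lie (vsval (j x)) (vsval (j y)); set b := lie (vsval x) (vsval y).
rewrite [lie (vsval (j x)) (vsval y)]lieC linearN /= -!semirep_tildeE => e.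
have ck : c \in k by apply: semidirect_ideal hk _ _ (subvsP _).
have bh : b \in h by apply: semidirect_subalg hk _ _ (subvsP _) (subvsP _).
(* The left-hand side is N_J(x, y) sorted by components: [j x, j y] is its k-part, and the other
   terms lie in h because J maps k to h. *)
have /semidirect_inj[] : vsval (semirep_tilde j x y - semirep_tilde j y x
      - vsproj h b) + vsval (vsproj k c)
    = vsval (0 : subvs_of h) + vsval (0 : subvs_of k).
  rewrite !linearB /= !vsprojK // ?linear0 addr0 -e.
  by rewrite addrC -[X in _ + X]addrA [X in _ + X]addrC !addrA [c - _ - b]addrAC.
move=> /subr0_eq/(congr1 vsval) e1 /(congr1 vsval) e2; split.
  by rewrite -(vsprojK ck) e2 linear0.
by rewrite -(vsprojK bh) -e1 linearB.
Qed.

(** Expanding [x1 + j y1, x2 + j y2], the mixed brackets are the pi terms of the connection;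
    integrability supplies [x1, x2] and kills [j y1, j y2]. *)
Lemma semidirect_conn_torsion_free :
  integrable (almost_complex j) -> torsion_free semidirect_conn.
Proof.
move=> intJ X Y /=; have [x1 [y1 ->]] := semidirect_decompj X.
have [x2 [y2 ->]] := semidirect_decompj Y.
rewrite !semidirect_connE !semirepE // opprD addrACA.
rewrite (integrable_components x1 x2 intJ).2 linearDl /= !linearDr /=.
rewrite (integrable_components y1 y2 intJ).1 addr0.
by rewrite [lie (vsval (j y1)) _]lieC addrA.
Qed.

End Semidirect.

Theorem theorem4p4 (R : realType) (g : lieAlgType R) (h k : {vspace g})
    (hk : is_semidirect h k)
    (j : 'Hom(subvs_of h, subvs_of k)) (j_bij : bijective j) :
  let J := almost_complex j in
  let F := paracomplex h k in
  let compatible (nabla : {bilinear g -> g -> g}) :=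
    [/\ torsion_free nabla, parallel nabla F & parallel nabla J] in
  ((exists nabla, compatible nabla) <-> integrable J)
  /\ (forall nabla, compatible nabla ->
        forall x1 x2 y1 y2 : subvs_of h,
          nabla (vsval x1 + vsval (j y1)) (vsval x2 + vsval (j y2))
          = vsval (semirep_tilde j x1 x2) + vsval (semirep k x1 (j y2)))
  /\ (forall nabla nabla' : {bilinear g -> g -> g},
        compatible nabla -> compatible nabla' ->
        forall X Y : g, nabla X Y = nabla' X Y).
Proof.
move=> J F compatible.
have two : 2%:R != 0 :> R by rewrite pnatr_eq0.
have formula nabla : compatible nabla -> forall x1 x2 y1 y2 : subvs_of h,
    nabla (vsval x1 + vsval (j y1)) (vsval x2 + vsval (j y2))
    = vsval (semirep_tilde j x1 x2) + vsval (semirep k x1 (j y2)).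
  by case=> tf pF pJ; apply: nablaE.
split; [split | split=> //].
- case=> nabla [tf _ pJ]; apply: torsion_free_parallel_integrable tf pJ.
  exact: almost_complexK.
- move=> intJ; exists (semidirect_conn _ _ _ k j); split.
  + exact: semidirect_conn_torsion_free.
  + exact: semidirect_conn_parallelF.
  + exact: semidirect_conn_parallelJ.
(* Since j is onto k, every vector is of the form x + j y, so the formula determines the
   connection. *)
- move=> nabla nabla' c c' X Y.
  have [x1 [y1 ->]] := semidirect_decompj _ _ _ _ hk j j_bij X.
  have [x2 [y2 ->]] := semidirect_decompj _ _ _ _ hk j j_bij Y.
  by rewrite !formula.
Qed.
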